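(* Let $cc_3(n)$ denote the number of partitions $\lambda$ of $n$ that are $3$-cores and whose hookset is an initial segment of the positive integers not divisible by $3$, i.e. $Hk(\lambda)=\{h\in\{1,\dots,H\}: 3\nmid h\}$ where $H$ is the largest element of $Hk(\lambda)$ (the empty partition of $0$ counts). Then $$\sum_{n\ge0} cc_3(n)\,q^n = 1+q+2\sum_{k\ge2}\left(q^{k^2}+q^{k^2-k}\right).$$
   Context: For a partition $\lambda=(\lambda_1\ge\dots\ge\lambda_\ell\ge1)$, the hook length of cell $(i,j)$ ($1\le i\le\ell$, $1\le j\le\lambda_i$) is $h_{ij}=\lambda_i-j+\lambda'_j-i+1$ with $\lambda'_j=|\{a:\lambda_a\ge j\}|$, and $Hk(\lambda)$ is the set of all hook lengths. $\lambda$ is a $3$-core if no hook length is a multiple of $3$. *)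

(* Defs.v *)
From mathcomp Require Import all_boot all_order all_algebra finmap.

Set Implicit Arguments.
Unset Strict Implicit.
Unset Printing Implicit Defensive.

Import GRing.Theory.

Local Open Scope nat_scope.

Implicit Types (la : seq nat) (i j n : nat).

Definition is_part n la : bool :=
  [&& sorted geq la, all (leq 1) la & sumn la == n].

(* Rows and columns are numbered from 1. *)
Definition part la i : nat := nth 0 la i.-1.

Definition conj_part la j : nat := count (leq j) la.

(* On a cell of the diagram neither subtraction truncates. *)
Definition hook_length la i j : nat :=
  (part la i - j) + (conj_part la j - i) + 1.

Definition hook_lengths la : seq nat :=
  [seq hook_length la i j | i <- iota 1 (size la), j <- iota 1 (part la i)].

Definition Hk la : {fset nat} := [fset h in hook_lengths la]%fset.

Definition is_core (t : nat) la : bool :=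
  all (fun h => ~~ (t %| h)) (hook_lengths la).

(* For the empty partition this is 0. *)
Definition max_hook la : nat := \max_(h <- hook_lengths la) h.

Definition initial_hookset la : bool :=
  Hk la == [fset h in iota 1 (max_hook la) | ~~ (3 %| h)]%fset.

(* A partition of n has at most n parts, each at most n, so it is a sequence of
   length at most n over {0, ..., n}; see [is_part_bseq]. *)
Definition cc3 n : nat :=
  #|[set b : n.-bseq 'I_n.+1 | let la := [seq val x | x <- b] in
      [&& is_part n la, is_core 3 la & initial_hookset la]]|.

Lemma is_part_bseq n la :
  is_part n la -> exists b : n.-bseq 'I_n.+1, [seq val x | x <- b] = la.
Proof.
case/and3P=> _ la_gt0 /eqP la_n.
have le_size : size la <= n.
  rewrite -{}la_n; elim: la la_gt0 => //= x la IH /andP[x_gt0 /IH le_la].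
  by rewrite -add1n leq_add.
have le_parts : all (fun x => x < n.+1) la.
  apply/allP=> x x_la; rewrite ltnS -la_n; elim: la x_la {la_gt0 la_n le_size}
    => //= y la IH; rewrite in_cons => /predU1P[->|/IH le_x].
    exact: leq_addr.
  exact: leq_trans le_x (leq_addl _ _).
have Eval : [seq val x | x <- pmap (insub : nat -> option 'I_n.+1) la] = la.
  rewrite (pmap_filter (insubK _)); apply/all_filterP.
  by apply: sub_all le_parts => x; rewrite isSome_insub.
have le_b : size (pmap (insub : nat -> option 'I_n.+1) la) <= n.
  by rewrite -(size_map val) Eval.
by exists (Bseq le_b).
Qed.

(* The polynomials P N converge, in the topology of formal power series (each
   coefficient is eventually constant), to the series \sum_n (a n) 'X^n. *)
Definition fps_limit (R : nzRingType) (P : nat -> {poly R}) (a : nat -> R) :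
    Prop :=
  forall n, exists K, forall N, K <= N -> ((P N)`_n = a n)%R.

(* Main.v *)
(* Let S be the set of first-column hook lengths (beta-numbers) of a partition.
   Its hook lengths are the differences x - y with x in S, y < x and y not in S,
   so the partition is a 3-core exactly when
   S = {1, 4, ..., 3a - 2} U {2, 5, ..., 3b - 1} for some (a, b).
   The size is then a^2 + b^2 + b - ab, and the hook lengths are the numbers
   congruent to 1 below 3 max(a, b - a) and those congruent to 2 below
   3 max(b, a - 1 - b). They form an initial segment exactly when a = b, a = 0,
   a = b + 1 or b = 0, and these four families have sizes b^2 + b, b^2 + b, a^2
   and a^2; they only meet in the pairs (0, 0) and (1, 0). *)

Require Import Defs.
From mathcomp Require Import all_boot all_order all_algebra finmap zify.

Import GRing.Theory.

Local Open Scope nat_scope.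

(** * Partitions and their beta-numbers *)

(* The first-column hook lengths, in decreasing order. *)
Fixpoint beta (la : seq nat) : seq nat :=
  if la is x :: la' then x + size la' :: beta la' else [::].

(** The inverse of [beta]. On a strictly decreasing sequence each entry is at least the number of
    later ones, so the subtraction does not truncate. *)
Fixpoint unbeta (s : seq nat) : seq nat :=
  if s is y :: s' then y - size s' :: unbeta s' else [::].

Lemma size_beta la : size (beta la) = size la.
Proof. by elim: la => //= x la ->. Qed.

Lemma size_unbeta s : size (unbeta s) = size s.
Proof. by elim: s => //= x s ->. Qed.

Lemma betaK : cancel beta unbeta.
Proof. by elim=> //= x la ->; rewrite size_beta addnK. Qed.

Lemma path_gtn_size y s : path gtn y s -> size s <= y.
Proof.
elim: s y => //= z s IH y /andP[lt_zy /IH le_sz].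
exact: leq_ltn_trans le_sz lt_zy.
Qed.

Lemma unbetaK s : sorted gtn s -> beta (unbeta s) = s.
Proof.
elim: s => //= y s IH s_path; rewrite IH ?(path_sorted s_path) //.
by rewrite size_unbeta subnK ?path_gtn_size.
Qed.

Lemma sorted_beta la : sorted geq la -> sorted gtn (beta la).
Proof.
elim: la => // x [|z la] IH //= /andP[le_zx /IH /= ->].
by rewrite andbT; lia.
Qed.

Lemma sorted_unbeta s : sorted gtn s -> sorted geq (unbeta s).
Proof.
elim: s => // y [|z s] IH //= /andP[lt_zy /IH /= ->].
by rewrite andbT; lia.
Qed.

Lemma beta_gt0 la : all (leq 1) la -> all (leq 1) (beta la).
Proof.
by elim: la => //= x la IH /andP[x_gt0 /IH ->]; rewrite andbT ltn_addr.
Qed.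

Lemma unbeta_gt0 s :
  sorted gtn s -> all (leq 1) s -> all (leq 1) (unbeta s).
Proof.
elim: s => //= y s IH y_path /andP[y_gt0 s_gt0].
(* All entries being positive, appending 0 keeps the sequence strictly decreasing, and its length
   gives the sharper bound [size s < y]. *)
rewrite IH ?(path_sorted y_path) // andbT subn_gt0 -(size_rcons s 0).
apply: path_gtn_size; rewrite rcons_path y_path /=.
by have /allP -> := mem_last y s; rewrite //= y_gt0.
Qed.

(** The shifts added to the parts are 0, 1, ..., [size la - 1]. *)
Lemma sumn_beta la : sumn (beta la) = sumn la + 'C(size la, 2).
Proof. by elim: la => //= x la ->; rewrite binS bin1; lia. Qed.

(** * Hook lengths as differences between beads and gaps *)

Lemma beta_lt x la y : path geq x la -> y \in beta la -> y < x + size la.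
Proof.
elim: la x => //= z la IH x /andP[le_zx z_path].
by rewrite in_cons => /predU1P[->|/(IH _ z_path)]; lia.
Qed.

(* A gap [y] below the bead [x + size la] corresponds to the column [j] whose
   vertical boundary step sits at position [y] of the rim. *)
Lemma notin_betaP x la y : path geq x la ->
  reflect (exists2 j, 0 < j <= x & y + count (leq j) la + 1 = j + size la)
    ((y < x + size la) && (y \notin beta la)).
Proof.
move=> x_path; apply/(iffP idP).
  elim: la x x_path => /= [|z la IH] x.
    by move=> _ /andP[lt_y _]; exists y.+1; lia.
  case/andP=> le_zx z_path /andP[lt_y]; rewrite in_cons negb_or.
  case/andP=> ne_y y_la; have [lt_yz|le_zy] := ltnP y (z + size la).
    have /(IH _ z_path)[j lej defy] : (y < z + size la) && (y \notin beta la).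
      by rewrite lt_yz.
    by exists j; lia.
  (* Gaps between the two topmost beads belong to the columns beyond [z], which only the first row
     meets. *)
  have la_lt j : z < j -> count (leq j) la = 0.
    move=> lt_zj; apply/eqP; rewrite -leqn0 leqNgt -has_count.
    apply/hasPn=> w w_la.
    have /allP/(_ _ w_la) /= := order_path_min (rev_trans leq_trans) z_path.
    lia.
  by exists (y - size la); rewrite ?la_lt; lia.
elim: la x x_path => /= [|z la IH] x; first by move=> _ [j lej]; lia.
case/andP=> le_zx z_path [j lej defy]; rewrite in_cons negb_or.
have le_count := count_size (leq j) la.
have [le_jz|lt_zj] := leqP j z.
  have /(IH _ z_path)/andP[] : exists2 j, 0 < j <= z
    & y + count (leq j) la + 1 = j + size la by exists j; lia.
  by move=> lt_y ->; lia.
have la_lt: count (leq j) la = 0.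
  apply/eqP; rewrite -leqn0 leqNgt -has_count.
  apply/hasPn=> w w_la.
  have /allP/(_ _ w_la) /= := order_path_min (rev_trans leq_trans) z_path.
  lia.
suff /negP->: ~ y \in beta la by lia.
by move/(beta_lt _ _ _ z_path); lia.
Qed.

(** The new top row meets column [j], so the column length and the row index both grow by one and
    the leg is unchanged. *)
Lemma hook_length_cons x la i j : 0 < i -> j <= x ->
  hook_length (x :: la) i.+1 j = hook_length la i j.
Proof.
rewrite /hook_length /part /conj_part /= => + ->.
by case: i => // i _ /=; rewrite add1n subSS.
Qed.

(** The ordinal [j] stands for column [j.+1] of the first row: its arm is [x - j.+1] and its leg
    counts the later rows reaching that column. *)
Lemma mem_hook_lengths_cons x la h : path geq x la ->
  h \in hook_lengths (x :: la) =
    [exists j : 'I_x, h == x - j + count (leq j.+1) la] ||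
    (h \in hook_lengths la).
Proof.
move=> x_path; apply/allpairsPdep/orP => /=.
  case=> i [j []]; rewrite in_cons => /predU1P[->{i}|i_la] j_x ->{h}.
    left; move: j_x; rewrite mem_iota /part /= => lej.
    have lt_j: j.-1 < x by lia.
    apply/existsP; exists (Ordinal lt_j); rewrite /hook_length /part /conj_part.
    by rewrite /= prednK; lia.
  right; case: i i_la j_x => [|[|i]]; rewrite mem_iota // => i_la j_x.
  have lt_i: i < size la by lia.
  have le_x: nth 0 la i <= x.
    by have /all_nthP->// := order_path_min (rev_trans leq_trans) x_path.
  apply/allpairsPdep; exists i.+1, j; split=> //.
    by rewrite mem_iota; lia.
  rewrite hook_length_cons //.
  by move: j_x; rewrite mem_iota /part /=; lia.
case=> [/existsP[j /eqP->] | /allpairsPdep[i [j []]]].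
  have lt_j := ltn_ord j.
  exists 1, j.+1; rewrite /hook_length /part /conj_part mem_iota /=.
  by split=> //; lia.
case: i => [|i]; rewrite mem_iota // => i_la j_x ->.
have lt_i: i < size la by lia.
have le_x: nth 0 la i <= x.
  by have /all_nthP->// := order_path_min (rev_trans leq_trans) x_path.
exists i.+2, j; split=> //.
  by rewrite -[_ :: _]/(iota 1 _.+1) mem_iota; lia.
rewrite hook_length_cons //.
by move: j_x; rewrite mem_iota /part /=; lia.
Qed.

(** Induction on rows. The hooks of the first row pair the top bead with the gaps below it, by
    [notin_betaP]; the top bead exceeds all others, so adding it fills no gap below them. *)
Lemma hook_lengthsP la h : sorted geq la ->
  reflect (exists x y, [/\ x \in beta la, y < x, y \notin beta la & h = x - y])
    (h \in hook_lengths la).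
Proof.
elim: la => [|x la IH] la_sorted.
  by apply: (iffP idP) => // -[? [? []]].
rewrite mem_hook_lengths_cons //; apply: (iffP orP) => /=.
  case=> [/existsP[j /eqP->] | /(IH (path_sorted la_sorted))[z [y]]].
    have /(notin_betaP _ _ _ la_sorted)/andP[] : exists2 k, 0 < k <= x
      & (j + size la - count (leq j.+1) la) + count (leq k) la + 1
          = k + size la.
      by exists j.+1; have := count_size (leq j.+1) la; have := ltn_ord j; lia.
    set y := _ - _ => lt_y y_la; exists (x + size la), y.
    have := count_size (leq j.+1) la; have := ltn_ord j.
    by rewrite !in_cons eqxx negb_or y_la; split=> //; lia.
  case=> z_la lt_yz y_la ->; exists z, y.
  have := beta_lt _ _ _ la_sorted z_la.
  by rewrite !in_cons z_la orbT negb_or y_la; split=> //; lia.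
case=> z [y]; rewrite !in_cons negb_or => -[+ lt_yz /andP[ne_y y_la] def_h].
case/predU1P=> [def_z | z_la]; [left | right].
  have /(notin_betaP _ _ _ la_sorted)[j lej defy] :
    (y < x + size la) && (y \notin beta la) by rewrite y_la -def_z lt_yz.
  have lt_j: j.-1 < x by lia.
  by apply/existsP; exists (Ordinal lt_j); rewrite /= def_h prednK; lia.
by apply/(IH (path_sorted la_sorted)); exists z, y.
Qed.

(** * Classification of 3-cores by pairs *)

Definition core_beta a b : seq nat :=
  sort geq (mkseq (fun i => 3 * i + 1) a ++ mkseq (fun i => 3 * i + 2) b).

Lemma mem_core_beta a b x : (x \in core_beta a b) =
  (x %% 3 == 1) && (x < 3 * a) || (x %% 3 == 2) && (x < 3 * b).
Proof.
rewrite mem_sort mem_cat; congr (_ || _).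
  apply/mapP/idP=> [[i]|lt_x]; first by rewrite mem_iota => ? ->; lia.
  by exists (x %/ 3); rewrite ?mem_iota; lia.
apply/mapP/idP=> [[i]|lt_x]; first by rewrite mem_iota => ? ->; lia.
by exists (x %/ 3); rewrite ?mem_iota; lia.
Qed.

Lemma sorted_core_beta a b : sorted gtn (core_beta a b).
Proof.
suff: sorted ltn (rev (core_beta a b)) by rewrite rev_sorted.
(* Weak order from sorting becomes strict because the two residue classes share no entry. *)
rewrite ltn_sorted_uniq_leq rev_uniq rev_sorted sort_sorted; last first.
  by move=> x y; apply: leq_total.
rewrite andbT sort_uniq cat_uniq !map_inj_uniq ?iota_uniq ?andbT /=;
  [|by move=> ? ?; lia..].
by apply/hasPn=> x /mapP[i _ ->]; apply/mapP=> -[j _]; lia.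
Qed.

Lemma core_beta_gt0 a b : all (leq 1) (core_beta a b).
Proof. by apply/allP=> -[|x //]; rewrite mem_core_beta. Qed.

Definition core_part a b : seq nat := unbeta (core_beta a b).

Lemma sorted_core_part a b : sorted geq (core_part a b).
Proof. exact/sorted_unbeta/sorted_core_beta. Qed.

Lemma beta_core_part a b : beta (core_part a b) = core_beta a b.
Proof. exact/unbetaK/sorted_core_beta. Qed.

Lemma core_part_inj a b c d :
  core_part a b = core_part c d -> (a, b) = (c, d).
Proof.
move/(congr1 beta); rewrite !beta_core_part => eq_beta.
have eq_mem1 i : (i < a) = (i < c).
  have := mem_core_beta a b (3 * i + 1).
  by rewrite eq_beta mem_core_beta; lia.
have eq_mem2 i : (i < b) = (i < d).
  have := mem_core_beta a b (3 * i + 2).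
  by rewrite eq_beta mem_core_beta; lia.
(* Two initial segments agree, so testing each at both endpoints forces equal lengths. *)
have := eq_mem1 a; have := eq_mem1 c; have := eq_mem2 b; have := eq_mem2 d.
by rewrite !ltnn => *; congr (_, _); lia.
Qed.

(** The sum of the beads less ['C(a + b, 2)]; the product [a * b] stands on the left to avoid a
    truncated subtraction. *)
Lemma sumn_core_part a b :
  sumn (core_part a b) + a * b = a ^ 2 + b ^ 2 + b.
Proof.
have := sumn_beta (core_part a b).
rewrite beta_core_part size_unbeta size_sort size_cat !size_mkseq.
rewrite (perm_sumn (permEl (perm_sort _ _))) sumn_cat => def_sum.
have sum1 c : 2 * sumn (mkseq (fun i => 3 * i + 1) c) + c = 3 * c ^ 2.
  by elim: c => // c IH; rewrite mkseqS sumn_rcons; lia.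
have sum2 c : 2 * sumn (mkseq (fun i => 3 * i + 2) c) = 3 * c ^ 2 + c.
  by elim: c => // c IH; rewrite mkseqS sumn_rcons; lia.
have bin2 c : 2 * 'C(c, 2) + c = c ^ 2.
  by elim: c => // c IH; rewrite binS bin1; lia.
have := sum1 a; have := sum2 b; have := bin2 (a + b); nia.
Qed.

(** The finite list [s] supplies a point where [P] fails; the bound is the least such point. *)
Lemma ex_bound (P : pred nat) (s : seq nat) : {subset P <= s} ->
  (forall i, P i.+1 -> P i) -> exists a, forall i, P i = (i < a).
Proof.
move=> sPs P_down.
have exPn: exists k, ~~ P k.
  exists (\max_(i <- s) i).+1; apply/negP=> /sPs s_k.
  by have := leq_bigmax_seq (P := xpredT) (F := id) _ s_k isT; rewrite ltnn.
have P_le i j : i <= j -> P j -> P i.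
  by move/subnK<-; elim: (j - i) => // d IH /P_down.
have [a Pa a_min] := ex_minnP exPn.
exists a => i; apply/idP/idP=> [Pi | lt_ia].
  by rewrite ltnNge; apply: contra Pa => /P_le; apply.
by apply: contraLR lt_ia => /a_min; rewrite -leqNgt.
Qed.

Lemma core3P la : sorted geq la -> all (leq 1) la ->
  reflect (exists a b, la = core_part a b) (is_core 3 la).
Proof.
move=> la_sorted la_gt0.
apply: (iffP idP) => [la_core | [a [b ->]]]; last first.
  apply/allP=> h /(hook_lengthsP _ _ (sorted_core_part a b))[x [y []]].
  by rewrite beta_core_part !mem_core_beta; lia.
have la_core3 x y :
    x \in beta la -> y < x -> y \notin beta la -> ~~ (3 %| x - y).
  move=> x_la lt_yx y_la; apply: (allP la_core).
  by apply/(hook_lengthsP _ _ la_sorted); exists x, y.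
have la_0 : 0 \notin beta la.
  by apply/negP=> /(allP (beta_gt0 _ la_gt0)).
(* Otherwise [x + 3] and the gap [x] would give a hook of length 3. *)
have la_down x : x + 3 \in beta la -> x \in beta la.
  by move/(la_core3 _ x)=> x_la; apply: contraT => /x_la; lia.
(* A bead divisible by 3 would form a forbidden hook with the gap 0. *)
have la_mod x : x \in beta la -> x %% 3 != 0.
  case: x => [|x]; first by rewrite (negPf la_0).
  by move/(la_core3 _ 0)/(_ isT la_0); lia.
have [a def_a] : exists a, forall i, (3 * i + 1 \in beta la) = (i < a).
  apply: (@ex_bound _ [seq x %/ 3 | x <- beta la]) => [i la_i|i la_i].
    by apply/mapP; exists (3 * i + 1) => //; lia.
  by apply: la_down; rewrite (_ : _ + 3 = 3 * i.+1 + 1) //; lia.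
have [b def_b] : exists b, forall i, (3 * i + 2 \in beta la) = (i < b).
  apply: (@ex_bound _ [seq x %/ 3 | x <- beta la]) => [i la_i|i la_i].
    by apply/mapP; exists (3 * i + 2) => //; lia.
  by apply: la_down; rewrite (_ : _ + 3 = 3 * i.+1 + 2) //; lia.
exists a, b; rewrite -[la]betaK; congr unbeta.
apply: (irr_sorted_eq (rev_trans ltn_trans) ltnn (sorted_beta _ la_sorted)
  (sorted_core_beta a b)) => x.
rewrite mem_core_beta {1}(divn_eq x 3) mulnC.
case def_r: (x %% 3) (ltn_pmod x (isT : 0 < 3)) => [|[|[|//]]] _.
- apply/negbTE/negP=> /la_mod; lia.
- by rewrite def_a; lia.
- by rewrite def_b; lia.
Qed.

(** * Hooksets of the 3-cores *)

Lemma mem_hooks_core_part a b h : (h \in hook_lengths (core_part a b)) =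
  (h %% 3 == 1) && (h < 3 * maxn a (b - a)) ||
  (h %% 3 == 2) && (h < 3 * maxn b (a.-1 - b)).
Proof.
apply/(hook_lengthsP _ _ (sorted_core_part a b))/idP; rewrite beta_core_part.
  case=> x [y []]; rewrite !mem_core_beta.
  by case/orP=> /andP[/eqP x3 lt_x] lt_yx y_ab ->; lia.
(* For each pair of distinct residues of bead and gap, the smallest gap of its class already
   realizes every difference: 0, [3 * a + 1] or [3 * b + 2]. The gap 0 yields the beads
   themselves. *)
case/orP=> /andP[/eqP h3]; rewrite maxnMr leq_max => /orP[] lt_h.
- exists h, 0; rewrite !mem_core_beta h3 lt_h subn0; split=> //; lia.
- exists (h + (3 * a + 1)), (3 * a + 1); rewrite !mem_core_beta addnK.
  by split=> //; lia.
- exists h, 0; rewrite !mem_core_beta h3 lt_h subn0 orbT; split=> //; lia.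
- exists (h + (3 * b + 2)), (3 * b + 2); rewrite !mem_core_beta addnK.
  by split=> //; lia.
Qed.

(** Downward closure among non-multiples of 3 avoids any mention of the maximum. *)
Lemma initial_hooksetP la : is_core 3 la ->
  reflect (forall h k, h \in hook_lengths la -> 0 < k <= h -> ~~ (3 %| k) ->
             k \in hook_lengths la)
    (initial_hookset la).
Proof.
move=> la_core; apply: (iffP eqP) => [def_Hk h k h_la lek k3 | la_init].
  have : k \in Hk la.
    rewrite def_Hk !inE mem_iota k3 andbT.
    have := leq_bigmax_seq (P := xpredT) (F := id) _ h_la isT.
    by rewrite /max_hook /=; lia.
  by rewrite !inE.
apply/fsetP=> k; rewrite !inE mem_iota; apply/idP/andP=> [k_la | [lek k3]].
  have k3 := allP la_core _ k_la; split=> //.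
  have := leq_bigmax_seq (P := xpredT) (F := id) _ k_la isT.
  by rewrite /max_hook /=; case: k k3 {k_la} => //= k; lia.
have [h h_la le_kh] : exists2 h, h \in hook_lengths la & k <= h.
  apply/hasP; apply: contraLR lek => /hasPn la_lt.
  suff : max_hook la <= k.-1 by lia.
  by apply/bigmax_leqP_seq=> h /la_lt; lia.
by apply: la_init h_la _ k3; lia.
Qed.

Lemma initial_core_part a b : initial_hookset (core_part a b) =
  [|| a == b, a == 0, a == b.+1 | b == 0].
Proof.
have mem0 q : (3 * q \in hook_lengths (core_part a b)) = false.
  by rewrite mem_hooks_core_part mulnC modnMl.
have mem1 q :
    (3 * q + 1 \in hook_lengths (core_part a b)) = (q < maxn a (b - a)).
  rewrite mem_hooks_core_part mulnC modnMDl /= orbF mulnC.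
  by move: (maxn _ _) => A; lia.
have mem2 q :
    (3 * q + 2 \in hook_lengths (core_part a b)) = (q < maxn b (a.-1 - b)).
  rewrite mem_hooks_core_part mulnC modnMDl /= mulnC.
  by move: (maxn _ _) => B; lia.
have core_ab: is_core 3 (core_part a b).
  apply/allP=> h h_ab; apply/negP=> /dvdnP[q def_h].
  by rewrite def_h mulnC mem0 in h_ab.
(* With [A] hooks of residue 1 and [B] of residue 2, the numbers 1, 2, 4, 5, ... alternate between
   the residues starting with 1, so nothing is skipped exactly when [B <= A <= B.+1]. *)
transitivity (maxn b (a.-1 - b) <= maxn a (b - a) <= (maxn b (a.-1 - b)).+1);
  last by lia.
move: {1 2 3}(maxn a _) {1 2 3}(maxn b _) mem1 mem2 => A B mem1 mem2.
apply/(initial_hooksetP _ core_ab)/andP => [init_ab | [leBA leAB] h k].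
  split.
    (* The largest hook of residue 2 forces its predecessor; below, the largest hook of residue 1
       forces the number two less. *)
    case: B mem2 => // B mem2; rewrite -mem1.
    apply: (init_ab (3 * B + 2)); rewrite ?mem2 //; first by lia.
    by rewrite mulnC /dvdn modnMDl.
  case: A mem1 => [|[|A]] // mem1; rewrite ltnS -mem2.
  apply: (init_ab (3 * A.+1 + 1)); rewrite ?mem1 //; first by lia.
  by rewrite mulnC /dvdn modnMDl.
rewrite (divn_eq h 3) (divn_eq k 3) /dvdn modnMDl ![_ * 3]mulnC.
move: (h %/ 3) (k %/ 3) (h %% 3) (k %% 3) (ltn_pmod h (isT : 0 < 3))
  (ltn_pmod k (isT : 0 < 3)) => {h k} q r.
case=> [|[|[|//]]] [|[|[|//]]] _ _ //=; rewrite ?addn0 ?mem0 // ?mem1 ?mem2;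
  lia.
Qed.

(** * Enumeration by size *)

(* The core partitions of size [k^2 - k], [k^2 - k], [k^2] and [k^2]
   respectively, for [2 <= k < N], preceded by those of size 0 and 1. *)
Definition initial_pairs N : seq (nat * nat) :=
  let s := index_iota 2 N in
  [:: (0, 0), (1, 0) & [seq (k.-1, k.-1) | k <- s] ++ [seq (0, k.-1) | k <- s]
    ++ [seq (k, k.-1) | k <- s] ++ [seq (k, 0) | k <- s]].

(** Starting at [k = 2] excludes (0, 0) and (1, 0), the only pairs where the families meet. *)
Lemma uniq_initial_pairs N : uniq (initial_pairs N).
Proof.
have map_uniq (f : nat -> nat * nat) : {in index_iota 2 N &, injective f} ->
    uniq [seq f k | k <- index_iota 2 N].
  by move=> f_inj; rewrite map_inj_in_uniq ?iota_uniq.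
rewrite /initial_pairs /= !in_cons !mem_cat !cat_uniq !map_uniq;
  try by move=> i j; rewrite !mem_index_iota => lei lej [*]; lia.
rewrite /= !andbT -!all_predC; apply/and5P; split.
- by apply/negP=> /or4P[] /mapP[k]; rewrite mem_index_iota => lek [*]; lia.
- by apply/negP=> /or4P[] /mapP[k]; rewrite mem_index_iota => lek [*]; lia.
- apply/allP=> p; rewrite !mem_cat => /or3P[] /mapP[k + ->] /=;
    rewrite mem_index_iota => lek;
    by apply/mapP=> -[m]; rewrite mem_index_iota => lem [*]; lia.
- apply/allP=> p; rewrite !mem_cat => /orP[] /mapP[k + ->] /=;
    rewrite mem_index_iota => lek;
    by apply/mapP=> -[m]; rewrite mem_index_iota => lem [*]; lia.
- apply/allP=> p => /mapP[k + ->] /=; rewrite mem_index_iota => lek;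
    by apply/mapP=> -[m]; rewrite mem_index_iota => lem [*]; lia.
Qed.

(** The bound on [N] leaves room for the index [k] of the pair, since [k < k ^ 2 - k + 2]. *)
Lemma mem_initial_pairs N a b : sumn (core_part a b) + 2 <= N ->
  ((a, b) \in initial_pairs N) = [|| a == b, a == 0, a == b.+1 | b == 0].
Proof.
move: (sumn _) (sumn_core_part a b) => w def_w le_w.
rewrite /initial_pairs !in_cons !mem_cat; apply/idP/idP.
  case/predU1P=> [[-> _] | /predU1P[[-> ->] // |]]; first by rewrite eqxx orbT.
  by case/or4P=> /mapP[k]; rewrite mem_index_iota => lek [-> ->]; lia.
case/or4P=> /eqP Eab; apply/orP; rewrite Eab in def_w *.
- case: b def_w {Eab} => [|b] def_w; [by left | right].
  apply/orP; right; apply/orP; left.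
  by apply/mapP; exists b.+2; rewrite ?mem_index_iota //; nia.
- case: b def_w {Eab} => [|b] def_w; [by left | right].
  apply/orP; right; apply/orP; right; apply/orP; left.
  by apply/mapP; exists b.+2; rewrite ?mem_index_iota //; nia.
- case: b def_w {Eab} => [|b] def_w; right; first by rewrite eqxx.
  apply/orP; right; do 2![apply/orP; right]; apply/orP; left.
  by apply/mapP; exists b.+2; rewrite ?mem_index_iota //; nia.
- case: a def_w => [|[|a]] def_w; [by left | by right | right].
  apply/orP; right; do 3![apply/orP; right].
  by apply/mapP; exists a.+2; rewrite ?mem_index_iota //; nia.
Qed.

Lemma cc3_count n N : n + 2 <= N ->
  cc3 n = count (fun p => sumn (core_part p.1 p.2) == n) (initial_pairs N).
Proof.
move=> le_nN; rewrite /cc3 cardE -size_filter.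
pose toseq (b : n.-bseq 'I_n.+1) : seq nat := [seq val x | x <- b].
have toseq_inj : injective toseq.
  by move=> b c /(inj_map val_inj) /val_inj.
(* Both counts become lengths of duplicate-free lists of partitions, which are then shown to have
   the same members. *)
rewrite -(size_map toseq) -(size_map (fun p => core_part p.1 p.2)).
apply/perm_size/uniq_perm.
- by rewrite map_inj_uniq ?enum_uniq.
- rewrite map_inj_uniq ?filter_uniq ?uniq_initial_pairs //.
  by move=> [a b] [c d] /core_part_inj.
move=> la; apply/mapP/mapP=> [[b + ->] | [[a b]]].
  rewrite mem_enum inE -/(toseq b) => /and3P[la_part la_core la_init].
  have [la_sorted la_gt0 /eqP la_n] := and3P la_part.
  have [c [d def_la]] := core3P _ la_sorted la_gt0 la_core.
  exists (c, d); last by [].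
  rewrite def_la in la_n la_init.
  rewrite mem_filter la_n eqxx mem_initial_pairs ?la_n //.
  by rewrite -initial_core_part.
rewrite mem_filter => /andP[/eqP/= la_n ab_init] -> /=.
have la_gt0 := unbeta_gt0 _ (sorted_core_beta a b) (core_beta_gt0 a b).
have la_part : is_part n (core_part a b).
  by rewrite /is_part sorted_core_part la_gt0 la_n /=.
have [c def_c] := is_part_bseq la_part.
exists c; last by [].
rewrite mem_enum inE def_c la_part initial_core_part.
rewrite -(mem_initial_pairs N) ?la_n // ab_init andbT.
by apply/(core3P _ (sorted_core_part a b) la_gt0); exists a, b.
Qed.

(** Each of the sizes [k ^ 2] and [k ^ 2 - k] arises from two families, whence the factor 2. *)
Lemma cc3E n N : n + 2 <= N ->
  cc3 n = (n == 0) + (n == 1)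
    + 2 * \sum_(2 <= k < N) ((n == k ^ 2) + (n == k ^ 2 - k)).
Proof.
move=> /cc3_count ->; rewrite /initial_pairs /= !count_cat !count_map.
have count_weight (f : nat -> nat * nat) (g : nat -> nat) :
    (forall k, 1 < k -> sumn (core_part (f k).1 (f k).2) = g k) ->
  count (preim f (fun p => sumn (core_part p.1 p.2) == n)) (index_iota 2 N)
    = \sum_(2 <= k < N) (n == g k).
  move=> def_g; rewrite -sumn_count sumnE big_map.
  by apply: eq_big_nat => k /andP[/def_g /= -> _]; rewrite eq_sym.
rewrite (count_weight (fun k => (k.-1, k.-1)) (fun k => k ^ 2 - k)); last first.
  by case=> // k _; have := sumn_core_part k k; rewrite /= -mulnn; nia.
rewrite (count_weight (fun k => (0, k.-1)) (fun k => k ^ 2 - k)); last first.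
  by case=> // k _; have := sumn_core_part 0 k; rewrite /= -mulnn; nia.
rewrite (count_weight (fun k => (k, k.-1)) (fun k => k ^ 2)); last first.
  by case=> // k _; have := sumn_core_part k.+1 k; rewrite /= -!mulnn; nia.
rewrite (count_weight (fun k => (k, 0)) (fun k => k ^ 2)); last first.
  by move=> k _; have := sumn_core_part k 0; rewrite /= -!mulnn; nia.
by rewrite big_split /=; lia.
Qed.

(** * The generating function *)

Local Open Scope ring_scope.

Theorem theorem6 :
  fps_limit
    (fun N => 1 + 'X + 2%:R *
       \sum_(2 <= k < N) ('X^(k ^ 2)%N + 'X^(k ^ 2 - k)%N) : {poly int})
    (fun n => (cc3 n)%:Z).
Proof.
(* From [N = n + 2] on, the coefficient of degree [n] has reached its final value. *)
move=> n; exists (n + 2)%N => N /cc3E ->.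
rewrite !coefD coef1 coefX mulr_natl coefMn coef_sum.
rewrite (eq_bigr (fun k => ((n == k ^ 2) + (n == k ^ 2 - k))%N%:R)).
  by rewrite -natr_sum -mulrnA mulnC -!natrD natz.
by move=> k _; rewrite coefD !coefXn natrD.
Qed.
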